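(* Let $R$ and $S$ be two loops (identity elements all denoted $\delta$), with maps $\varphi:S\times R\to R$ and $\psi:S\times R\to S$ satisfying $$\varphi(s,\delta)=\delta,\qquad \varphi(\delta,r)=r,\qquad \psi(s,\delta)=s,\qquad \psi(\delta,r)=\delta$$ for all $s\in S$, $r\in R$. Then a loop $Q$ is isomorphic to the loop $R\bowtie S:=R\times S$ with the multiplication given by $$(r,s)(r',s'):=(r\,\varphi(s,r'),\,\psi(s,r')s')$$ if and only if there are quasigroup homomorphisms $i_S:S\to Q$, $i_R:R\to Q$, together with maps $p_R:Q\to R$ and $p_S:Q\to S$ satisfying the Moufang-type identities $$p_R\big((i_R(r)i_S(s))(i_R(r')i_S(s'))\big)=p_R(i_R(r))\Big(p_R(i_S(s)i_R(r'))\,p_R(i_S(s'))\Big)=\Big(p_R(i_R(r))\,p_R(i_S(s)i_R(r'))\Big)p_R(i_S(s'))$$ and $$p_S\big((i_R(r)i_S(s))(i_R(r')i_S(s'))\big)=p_S(i_R(r))\Big(p_S(i_S(s)i_R(r'))\,p_S(i_S(s'))\Big)=\Big(p_S(i_R(r))\,p_S(i_S(s)i_R(r'))\Big)p_S(i_S(s'))$$ for all $r,r'\in R$ and $s,s'\in S$, as well as $p_R\circ i_R=\mathrm{Id}_R$ and $p_S\circ i_S=\mathrm{Id}_S$, such that the maps $R\bowtie S\to Q$, $(r,s)\mapsto i_R(r)i_S(s)$, and $Q\to R\bowtie S$, $q\mapsto(p_R(q),p_S(q))$, are inverse to each other.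
   Context: A quasigroup is a set $Q$ with a binary multiplication such that for all $a,b\in Q$ there are unique $x,y\in Q$ with $ax=b$ and $ya=b$. A loop is a quasigroup with an element $\delta$ such that $x\delta=\delta x=x$ for all $x$. A quasigroup homomorphism is a map $f$ with $f(xy)=f(x)f(y)$ for all $x,y$; an isomorphism is a bijective homomorphism.
   Formalization: For fixed φ, ψ the ''if'' direction is false (R=Z/3, S=Z/2, R⋈S=S_3, Q=Z/3×Z/2). Proved instead: the equivalence with φ, ψ existentially quantified, and, for given φ, ψ, the equivalence with the added condition φ(s,r)=p_R(i_S(s)i_R(r)), ψ(s,r)=p_S(i_S(s)i_R(r)). *)

(* Defs.v *)
From HB Require Import structures.
From mathcomp Require Import all_boot.

Set Implicit Arguments.
Unset Strict Implicit.
Unset Printing Implicit Defensive.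

Import Algebra.

Local Open Scope group_scope.

(* Only the Magma and BaseUMagma structures of mathcomp are used: unlike UMagma
   and above, they do not require the carrier to be a choiceType. *)

HB.mixin Record Magma_isQuasigroup G of Magma G := {
  ex_unique_ldiv : forall a b : G, exists! x : G, a * x = b;
  ex_unique_rdiv : forall a b : G, exists! y : G, y * a = b
}.

#[short(type="quasigroupType")]
HB.structure Definition Quasigroup := {G of Magma_isQuasigroup G & Magma G}.

HB.mixin Record hasOne_isLoop G of BaseUMagma G := {
  loop_mul1g : left_id (1 : G) *%g;
  loop_mulg1 : right_id (1 : G) *%g
}.

#[short(type="loopType")]
HB.structure Definition Loop :=
  {G of hasOne_isLoop G & Quasigroup G & BaseUMagma G}.

Definition normalized (R S : loopType) (phi : S -> R -> R) (psi : S -> R -> S)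
    : Prop :=
  [/\ forall s : S, phi s 1 = 1,
      forall r : R, phi 1 r = r,
      forall s : S, psi s 1 = s &
      forall r : R, psi 1 r = 1].

(* An alias of R * S, which already carries the direct product law. When phi and
   psi are normalized, (1, 1) is a unit, but the divisions of a quasigroup need
   not exist, hence only a magma structure; being isomorphic to a loop makes it
   a loop. *)
Definition bowtie (R S : loopType) (phi : S -> R -> R) (psi : S -> R -> S)
    : Type :=
  (R * S)%type.

HB.instance Definition _ (R S : loopType) (phi : S -> R -> R)
    (psi : S -> R -> S) :=
  hasMul.Build (bowtie phi psi)
    (fun x y : R * S => (x.1 * phi x.2 y.1, psi x.2 y.1 * y.2)).

Definition isomorphic (G H : magmaType) : Prop :=
  exists f : {multiplicative G -> H}, bijective f.

(* T is R (with p = p_R) or S (with p = p_S). *)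
Definition Moufang_type (R S Q T : loopType) (iR : R -> Q) (iS : S -> Q)
    (p : Q -> T) : Prop :=
  forall (r r' : R) (s s' : S),
    p ((iR r * iS s) * (iR r' * iS s'))
      = p (iR r) * (p (iS s * iR r') * p (iS s')) /\
    p (iR r) * (p (iS s * iR r') * p (iS s'))
      = (p (iR r) * p (iS s * iR r')) * p (iS s').

(* The underlying set of R bowtie S is R * S whatever phi and psi are. *)
Definition factorization (R S Q : loopType)
    (iR : {multiplicative R -> Q}) (iS : {multiplicative S -> Q})
    (pR : Q -> R) (pS : Q -> S) : Prop :=
  [/\ Moufang_type iR iS pR /\ Moufang_type iR iS pS,
      (forall r : R, pR (iR r) = r) /\ (forall s : S, pS (iS s) = s),
      forall x : R * S, (pR (iR x.1 * iS x.2), pS (iR x.1 * iS x.2)) = x &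
      forall q : Q, iR (pR q) * iS (pS q) = q].

(* Main.v *)
(* Under an isomorphism of Q with R bowtie S, the elements (r, 1) and (1, s)
   form copies of R and S, (r, 1)(1, s) = (r, s), and (1, s)(r, 1) =
   (phi s r, psi s r). Conversely phi and psi are read off a factorization as
   the components of iS s * iR r; as pR (iS s) and pS (iR r) are trivial, the
   Moufang-type identities say precisely that q |-> (pR q, pS q) is
   multiplicative. *)

Require Import Defs.
From HB Require Import structures.
From mathcomp Require Import all_boot.

Set Implicit Arguments.
Unset Strict Implicit.
Unset Printing Implicit Defensive.

Import Algebra.
Local Open Scope group_scope.

(** Both [a] and [1] solve [a * x = a], and left division is unique. *)
Lemma loop_idempotent1 (Q : loopType) (a : Q) : a * a = a -> a = 1.
Proof.
move=> aa; have [x [_ xP]] := ex_unique_ldiv a a.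
by rewrite -(xP a aa); apply: xP; exact: loop_mulg1.
Qed.

(** A multiplicative map carries no unit axiom, but [f 1] is idempotent. *)
Lemma loop_morph1 (R Q : loopType) (f : {multiplicative R -> Q}) : f 1 = 1.
Proof. by apply: loop_idempotent1; rewrite -gmulfM loop_mulg1. Qed.

Section Bowtie.
Variables (R S : loopType) (phi : S -> R -> R) (psi : S -> R -> S).

Lemma bowtieM (r r' : R) (s s' : S) :
  ((r, s) : bowtie phi psi) * ((r', s') : bowtie phi psi)
  = (r * phi s r', psi s r' * s') :> bowtie phi psi.
Proof. by []. Qed.

Hypothesis norm : normalized phi psi.

(** The conditions at [1 : S] make [r |-> (r, 1)] multiplicative; those at [1 : R] do the same for
    [s |-> (1, s)] in [bowtieMr]. *)
Lemma bowtieMl (r r' : R) :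
  ((r, 1) : bowtie phi psi) * ((r', 1) : bowtie phi psi)
  = (r * r', 1) :> bowtie phi psi.
Proof.
by case: norm => _ phi1 _ psi1; rewrite bowtieM phi1 psi1 loop_mulg1.
Qed.

Lemma bowtieMr (s s' : S) :
  ((1, s) : bowtie phi psi) * ((1, s') : bowtie phi psi)
  = (1, s * s') :> bowtie phi psi.
Proof.
by case: norm => phis1 _ psis1 _; rewrite bowtieM phis1 psis1 loop_mulg1.
Qed.

Lemma bowtie_factor (r : R) (s : S) :
  ((r, 1) : bowtie phi psi) * ((1, s) : bowtie phi psi)
  = (r, s) :> bowtie phi psi.
Proof.
case: norm => _ phi1 _ psi1.
by rewrite bowtieM phi1 psi1 loop_mulg1 loop_mul1g.
Qed.

Lemma bowtie_swap (s : S) (r : R) :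
  ((1, s) : bowtie phi psi) * ((r, 1) : bowtie phi psi)
  = (phi s r, psi s r) :> bowtie phi psi.
Proof. by rewrite bowtieM loop_mulg1 loop_mul1g. Qed.

End Bowtie.

(** The last conjunct records that the factorization recovers the given [phi] and [psi], not just
    some normalized pair. *)
Lemma isomorphic_factorization (R S Q : loopType) (phi : S -> R -> R)
    (psi : S -> R -> S) :
  normalized phi psi -> isomorphic Q (bowtie phi psi) ->
  exists (iS : {multiplicative S -> Q}) (iR : {multiplicative R -> Q})
         (pR : Q -> R) (pS : Q -> S),
    factorization iR iS pR pS /\
    (forall (s : S) (r : R), phi s r = pR (iS s * iR r) /\
                             psi s r = pS (iS s * iR r)).
Proof.
move=> norm [f [g fK gK]].
have gM x y : g (x * y) = g x * g y.
  by apply: (can_inj fK); rewrite gmulfM !gK.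
pose iR (r : R) : Q := g (r, 1); pose iS (s : S) : Q := g (1, s).
have iRM r r' : iR (r * r') = iR r * iR r'.
  by rewrite /iR -gM bowtieMl.
have iSM s s' : iS (s * s') = iS s * iS s'.
  by rewrite /iS -gM bowtieMr.
pose mR := isMultiplicative.Build R Q iR iRM.
pose mS := isMultiplicative.Build S Q iS iSM.
pose iR' : {multiplicative R -> Q} := HB.pack iR mR.
pose iS' : {multiplicative S -> Q} := HB.pack iS mS.
have fR r : f (iR r) = (r, 1) by rewrite gK.
have fS s : f (iS s) = (1, s) by rewrite gK.
have fRS r s : f (iR r * iS s) = (r, s).
  by rewrite gmulfM fR fS bowtie_factor.
have fSR s r : f (iS s * iR r) = (phi s r, psi s r).
  by rewrite gmulfM fR fS bowtie_swap.
exists iS', iR', (fun q => (f q).1), (fun q => (f q).2).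
split; last by move=> s r /=; rewrite fSR.
split.
(* Each triple product has an outer factor [1], namely [pR (iS s')] in [R] and [pS (iR r)] in [S],
   so the two bracketings agree. *)
- by split=> r r' s s' /=; rewrite gmulfM !fRS fR fS fSR bowtieM /=
    ?loop_mulg1 ?loop_mul1g.
- by split=> [r|s] /=; rewrite (fR, fS).
- by case=> r s /=; rewrite fRS.
- by move=> q /=; apply: (can_inj fK); rewrite fRS -surjective_pairing.
Qed.

Section Factorization.
Variables (R S Q : loopType).
Variables (iR : {multiplicative R -> Q}) (iS : {multiplicative S -> Q}).
Variables (pR : Q -> R) (pS : Q -> S).
Hypothesis fact : factorization iR iS pR pS.

(** As [iR 1 = 1], the pair [(1, s)] is sent to [iS s], and the projections recover it. *)
Lemma factorization_pRS (s : S) : pR (iS s) = 1.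
Proof.
case: fact => _ _ /(_ (1, s)) + _.
by rewrite /= loop_morph1 loop_mul1g => -[].
Qed.

Lemma factorization_pSR (r : R) : pS (iR r) = 1.
Proof.
case: fact => _ _ /(_ (r, 1)) + _.
by rewrite /= loop_morph1 loop_mulg1 => -[].
Qed.

Lemma factorization_normalized :
  normalized (fun s r => pR (iS s * iR r)) (fun s r => pS (iS s * iR r)).
Proof.
case: fact => _ [pRK pSK] _ _.
split=> x; rewrite loop_morph1 ?loop_mulg1 ?loop_mul1g //.
  exact: factorization_pRS.
exact: factorization_pSR.
Qed.

Lemma factorization_isomorphic (phi : S -> R -> R) (psi : S -> R -> S) :
  (forall s r, phi s r = pR (iS s * iR r) /\ psi s r = pS (iS s * iR r)) ->
  isomorphic Q (bowtie phi psi).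
Proof.
move=> phipsiE; case: fact => -[mR mS] [pRK pSK] pK iK.
pose f (q : Q) : bowtie phi psi := (pR q, pS q).
have fM x y : f (x * y) = f x * f y.
  (* Only [x] and [y] under [pR] and [pS] on the left are factored, which gives the product the
     shape of the Moufang-type identities. *)
  rewrite {1}/f -{1 2}(iK x) -{1 2}(iK y).
  rewrite (mR _ _ _ _).1 (mS _ _ _ _).1 !pRK !pSK.
  rewrite factorization_pRS factorization_pSR loop_mulg1 loop_mul1g.
  by rewrite bowtieM (phipsiE _ _).1 (phipsiE _ _).2.
pose mf := isMultiplicative.Build Q (bowtie phi psi) f fM.
pose f' : {multiplicative Q -> bowtie phi psi} := HB.pack f mf.
by exists f', (fun x : R * S => iR x.1 * iS x.2).
Qed.

End Factorization.

(** The statement is proved both for some [phi] and [psi] and for given ones. Since [factorization]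
    does not mention them, the second form ties them to the components of [iS s * iR r]. *)
Theorem proposition2p8 (R S Q : loopType) :
  ((exists (phi : S -> R -> R) (psi : S -> R -> S),
      normalized phi psi /\ isomorphic Q (bowtie phi psi)) <->
   (exists (iS : {multiplicative S -> Q}) (iR : {multiplicative R -> Q})
           (pR : Q -> R) (pS : Q -> S),
      factorization iR iS pR pS)) /\
  (forall (phi : S -> R -> R) (psi : S -> R -> S), normalized phi psi ->
     (isomorphic Q (bowtie phi psi) <->
      (exists (iS : {multiplicative S -> Q}) (iR : {multiplicative R -> Q})
              (pR : Q -> R) (pS : Q -> S),
         factorization iR iS pR pS /\
         (forall (s : S) (r : R), phi s r = pR (iS s * iR r) /\
                                  psi s r = pS (iS s * iR r))))).
Proof.
split=> [|phi psi norm].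
- split=> [[phi [psi [norm iso]]] | [iS [iR [pR [pS fact]]]]].
    have [iS [iR [pR [pS [fact _]]]]] := isomorphic_factorization norm iso.
    by exists iS, iR, pR, pS.
  pose phi s r := pR (iS s * iR r); pose psi s r := pS (iS s * iR r).
  exists phi, psi; split; first exact: factorization_normalized fact.
  exact (factorization_isomorphic fact (fun s r => conj erefl erefl)).
- split=> [|[iS [iR [pR [pS [fact phipsiE]]]]]].
    exact: isomorphic_factorization.
  exact (factorization_isomorphic fact phipsiE).
Qed.
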